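(* Let $E_1|H_1,\ldots,E_n|H_n$ be $n$ arbitrary conditional events, and let $\mathcal{C}_n=\bigwedge_{i=1}^n(E_i|H_i)$ and $\mathcal{D}_n=\bigvee_{i=1}^n(E_i|H_i)$. Then: (i) $\mathcal{C}_n\in[0,1]$; (ii) $\mathcal{D}_n\in[0,1]$ (that is, all the values of these random quantities lie in $[0,1]$).
   Context: Events are two-valued propositions (identified with subsets of the sure event $\Omega$, and with their indicators); $\overline{A}$ is negation, $AB$ is conjunction. For events $E,H$ with $H\neq\emptyset$, the conditional event $E|H$ is true if $EH$ is true, false if $\overline{E}H$ is true, void if $\overline{H}$ is true. A conditional random quantity $X|H$ ($X$ with finitely many values, $H\ne\emptyset$) with assessed prevision $\mu=\mathbb{P}(X|H)$ is identified with the random quantity $XH+\mu\overline{H}$; in particular $E|H=EH+x\overline{H}$ with $x=P(E|H)$. Coherence: an assessment of previsions $\mu_j=\mathbb{P}(X_j|K_j)$ on a family of conditional random quantities is coherent if, for every finite subfamily $\{X_1|K_1,\ldots,X_r|K_r\}$ and all real $s_1,\ldots,s_r$, the gain $G=\sum_j s_jK_j(X_j-\mu_j)$ restricted to $K_1\vee\cdots\vee K_r$ satisfies $\min G\leq 0\leq\max G$. Conjunction and disjunction. For each nonempty $S\subseteq\{1,\ldots,n\}$ let $x_S$ and $y_S$ denote the assessed previsions of $\bigwedge_{i\in S}(E_i|H_i)$ and $\bigvee_{i\in S}(E_i|H_i)$ ($x_{\{i\}}=y_{\{i\}}=P(E_i|H_i)$). The conjunction $\bigwedge_{i\in S}(E_i|H_i)$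 is the random quantity, conditional on $\bigvee_{i\in S}H_i$, with value $1$ if all $E_i|H_i$, $i\in S$, are true; $0$ if at least one is false; $x_V$ if none is false and the set $V\subseteq S$ of indices of void ones is nonempty. The disjunction $\bigvee_{i\in S}(E_i|H_i)$ is the random quantity, conditional on $\bigvee_{i\in S}H_i$, with value $1$ if at least one $E_i|H_i$, $i\in S$, is true; $0$ if all are false; $y_V$ if none is true and the set $V\subseteq S$ of indices of void ones is nonempty. Convention: the numbers $x_S$ and $y_S$ always form a coherent assessment on the family of all these compounds; the assertions hold for every such coherent assessment. *)

(* Defs.v *)
From HB Require Import structures.
From mathcomp Require Import all_boot all_order all_algebra.
From mathcomp Require Import all_classical all_reals numfun.

Set Implicit Arguments.
Unset Strict Implicit.
Unset Printing Implicit Defensive.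

Import Order.TTheory GRing.Theory Num.Theory.

Local Open Scope classical_set_scope.
Local Open Scope ring_scope.

Record condEvent (Omega : Type) := CondEvent {
  ce_event : set Omega;
  ce_cond : set Omega;
  ce_cond_neq0 : ce_cond !=set0 }.

Section Status.
Variables (Omega : Type) (A : condEvent Omega).

Definition ce_true : set Omega := ce_event A `&` ce_cond A.
Definition ce_false : set Omega := ~` ce_event A `&` ce_cond A.
Definition ce_void : set Omega := ~` ce_cond A.

End Status.

(* X|K; only the values of X on K are ever relevant. *)
Record condRQ (R : realType) (Omega : Type) := CondRQ {
  crq_fun : Omega -> R;
  crq_cond : set Omega;
  crq_finite : finite_set (range crq_fun);
  crq_cond_neq0 : crq_cond !=set0 }.

(* The identification of X|K, with assessed prevision mu, with the random
   quantity X K + mu (not K). *)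
Definition crq_val (R : realType) (Omega : Type) (X : condRQ R Omega) (mu : R)
    (w : Omega) : R :=
  crq_fun X w * \1_(crq_cond X) w + mu * \1_(~` crq_cond X) w.

Section Coherence.
Variables (R : realType) (Omega : Type).

Definition is_minimum (B : set R) (m : R) : Prop := B m /\ lbound B m.
Definition is_maximum (B : set R) (M : R) : Prop := B M /\ ubound B M.

Definition gain (r : nat) (X : 'I_r -> condRQ R Omega) (mu s : 'I_r -> R)
    (w : Omega) : R :=
  \sum_(j < r) s j * \1_(crq_cond (X j)) w * (crq_fun (X j) w - mu j).

(* The empty subfamily is excluded: its gain would be restricted to the
   impossible event.  The minimum and the maximum always exist, since the gain
   has finitely many values and the union of the conditioning events is
   nonempty. *)
Definition coherent (I : Type) (X : I -> condRQ R Omega) (mu : I -> R) : Prop :=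
  forall (r : nat) (k : 'I_r -> I) (s : 'I_r -> R),
    (0 < r)%N -> injective k ->
    let K := \bigcup_(j : 'I_r) crq_cond (X (k j)) in
    let G := gain (X \o k) (mu \o k) s @` K in
    exists m M, [/\ is_minimum G m, is_maximum G M & m <= 0 <= M].

End Coherence.

Section Compounds.
Variables (R : realType) (Omega : Type) (n : nat).
Variable E : 'I_n -> condEvent Omega.

Definition void_set (S : {set 'I_n}) (w : Omega) : {set 'I_n} :=
  [set i in S | w \in ce_void (E i)]%SET.

(* x V is only used at a nonempty V: when no E_i|H_i (i in S) is void, one of
   the first two cases applies.  When V = S, i.e. outside the disjunction of
   the H_i, the value is the prevision x S itself.  Likewise for y below. *)
Definition conj_fun (x : {set 'I_n} -> R) (S : {set 'I_n}) (w : Omega) : R :=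
  if [forall i in S, w \in ce_true (E i)] then 1
  else if [exists i in S, w \in ce_false (E i)] then 0
  else x (void_set S w).

Definition disj_fun (y : {set 'I_n} -> R) (S : {set 'I_n}) (w : Omega) : R :=
  if [exists i in S, w \in ce_true (E i)] then 1
  else if [forall i in S, w \in ce_false (E i)] then 0
  else y (void_set S w).

Definition comp_cond (S : {set 'I_n}) : set Omega :=
  \bigcup_(i in [set` S]) ce_cond (E i).

Lemma finite_range_if3 (x : {set 'I_n} -> R) (b c : Omega -> bool)
    (V : Omega -> {set 'I_n}) :
  finite_set (range (fun w => if b w then 1 else if c w then 0 else x (V w))).
Proof.
apply: (@sub_finite_set _ _ ([set 0; 1] `|` range x)); last first.
  rewrite finite_setU; split; first exact: finite_set2.
  exact/finite_image/finite_finset.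
move=> _ [w _ <-]; case: (b w); first by left; right.
by case: (c w); [left; left | right; exists (V w)].
Qed.

Lemma comp_cond_neq0 (S : {set 'I_n}) : S != finset.set0 -> comp_cond S !=set0.
Proof.
case/set0Pn=> i iS; have [w Hw] := ce_cond_neq0 (E i).
by exists w, i.
Qed.

Definition conjunction (x : {set 'I_n} -> R) (S : {set 'I_n})
    (S0 : S != finset.set0) : condRQ R Omega :=
  @CondRQ R Omega (conj_fun x S) (comp_cond S)
    (finite_range_if3 x _ _ _) (comp_cond_neq0 S0).

Definition disjunction (y : {set 'I_n} -> R) (S : {set 'I_n})
    (S0 : S != finset.set0) : condRQ R Omega :=
  @CondRQ R Omega (disj_fun y S) (comp_cond S)
    (finite_range_if3 y _ _ _) (comp_cond_neq0 S0).

Definition neset : Type := {S : {set 'I_n} | S != finset.set0}.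

(* The family of all compounds is indexed by two copies of the nonempty index
   sets: inl U is the conjunction over U, inr U the disjunction over U. *)
Definition compound (x y : {set 'I_n} -> R) (k : neset + neset) :
    condRQ R Omega :=
  match k with
  | inl U => conjunction x (valP U)
  | inr U => disjunction y (valP U)
  end.

Definition compound_prevision (x y : {set 'I_n} -> R) (k : neset + neset) : R :=
  match k with
  | inl U => x (val U)
  | inr U => y (val U)
  end.

Definition coherent_compounds (x y : {set 'I_n} -> R) : Prop :=
  (forall i : 'I_n, x [set i]%SET = y [set i]%SET) /\
  coherent (compound x y) (compound_prevision x y).

End Compounds.

Lemma setT_ord_neq0 (n : nat) : (0 < n)%N -> [set: 'I_n]%SET != finset.set0.
Proof. by move=> n0; apply/set0Pn; exists (Ordinal n0); rewrite inE. Qed.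

(* Main.v *)
Require Import Defs.
From mathcomp Require Import all_boot all_order all_algebra.
From mathcomp Require Import all_classical all_reals.
From mathcomp Require Import numfun.

(** The gain of a single bet on [X|K] is a multiple of [X - mu] on [K], so
    coherence forces the prevision [mu] to lie between two values taken by [X]
    on [K] ([coherent_between]).  On the disjunction of the [H_i], [i] in [S],
    a compound over [S] takes only the values [0], [1] and previsions of the
    same kind of compound over void sets [V], and such a [V] is nonempty,
    and it is strictly smaller than [S] because some [H_i] holds.  By strong induction on
    the cardinal of [S], every prevision lies in [[0, 1]]
    ([prevision_between01]), and hence so does every value of a compound.
    Conjunctions and disjunctions only enter through the recursive shape of
    their values, so one induction serves both. *)

Import Order.TTheory GRing.Theory Num.Theory.

Local Open Scope ring_scope.

(** A unit bet on the single quantity [X k] has gain [X k - mu k] on its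
    conditioning event; its extrema are attained there, at [w1] and [w2]. *)
Lemma coherent_between {R : realType} {Omega I : Type}
    {X : I -> condRQ R Omega} {mu : I -> R} (k : I) :
  coherent X mu ->
  exists w1 w2 : Omega,
    [/\ crq_cond (X k) w1, crq_cond (X k) w2 &
        crq_fun (X k) w1 <= mu k <= crq_fun (X k) w2].
Proof.
move=> coh.
have k_inj : injective (fun _ : 'I_1 => k) by move=> i j _; rewrite !ord1.
have /= := coh 1%N (fun=> k) (fun=> 1) isT k_inj.
case=> m [M [[[w1 [i1 _ Kw1] <-] _] [[w2 [i2 _ Kw2] <-] _]]].
rewrite /gain !big_ord1 /= !indicE (mem_set Kw1) (mem_set Kw2) !mul1r.
by rewrite subr_le0 subr_ge0 => bds; exists w1, w2.
Qed.

(** This forgets which outcome produces which value, the only point where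
    conjunctions and disjunctions differ.  Nonemptiness of [V] is kept because
    coherence says nothing about [p] at the empty set; properness of [V] makes
    the recursion well founded. *)
Definition recursive_value {R : realType} {n : nat} (p : {set 'I_n} -> R)
    (S : {set 'I_n}) (v : R) : Prop :=
  [\/ v = 0, v = 1 |
      exists2 V : {set 'I_n}, V != finset.set0 & V \proper S /\ v = p V].

Lemma recursive_value_between01 {R : realType} {n : nat}
    {p : {set 'I_n} -> R} {S : {set 'I_n}} {v : R} :
  (forall V : {set 'I_n}, V != finset.set0 -> V \proper S -> 0 <= p V <= 1) ->
  recursive_value p S v -> 0 <= v <= 1.
Proof.
move=> p01 [-> | -> | [V V0 [VS ->]]]; last exact: p01.
- by rewrite lexx ler01.
- by rewrite lexx ler01.
Qed.

(** Strong induction on [#|S|]: the bounds [v1] and [v2] of [p S] involve [p]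
    only at smaller sets.  A singleton has no nonempty proper subset, so there
    they are [0] or [1], which starts the induction. *)
Lemma prevision_between01 {R : realType} {n : nat} (p : {set 'I_n} -> R) :
  (forall S : {set 'I_n}, S != finset.set0 ->
     exists v1 v2 : R, [/\ recursive_value p S v1, recursive_value p S v2 &
                           v1 <= p S <= v2]) ->
  forall S : {set 'I_n}, S != finset.set0 -> 0 <= p S <= 1.
Proof.
move=> p_between S; have [m] := ubnP #|S|; elim: m S => // m IHm S Sm S0.
have IH (V : {set 'I_n}) : V != finset.set0 -> V \proper S -> 0 <= p V <= 1.
  move=> V0 VS; apply: IHm => //.
  exact: leq_trans (proper_card VS) Sm.
have [v1 [v2 [rv1 rv2 /andP[v1p pv2]]]] := p_between S S0.
have /andP[v1_ge0 _] := recursive_value_between01 IH rv1.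
have /andP[_ v2_le1] := recursive_value_between01 IH rv2.
by rewrite (le_trans v1_ge0 v1p) (le_trans pv2 v2_le1).
Qed.

Lemma in_ce_void {Omega : Type} (A : condEvent Omega) (w : Omega) :
  (w \in ce_void A) = (w \notin ce_true A) && (w \notin ce_false A).
Proof.
rewrite /ce_void /ce_true /ce_false !in_setI !in_setC.
by case: (w \in ce_event A); case: (w \in ce_cond A).
Qed.

(** An index whose conditioning event holds at [w] is not void. *)
Lemma void_set_proper {Omega : Type} {n : nat} (E : 'I_n -> condEvent Omega)
    {S : {set 'I_n}} {w : Omega} :
  comp_cond E S w -> void_set E S w \proper S.
Proof.
case=> i iS Hiw; apply/properP; split.
  by apply/fintype.subsetP => j; rewrite inE => /andP[].
by exists i => //; rewrite inE negb_and in_setC negbK (mem_set Hiw) orbT.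
Qed.

(** In the third case some conditional event is not true and none is false, so
    that one is void. *)
Lemma conj_fun_recursive {R : realType} {Omega : Type} {n : nat}
    (E : 'I_n -> condEvent Omega) (x : {set 'I_n} -> R)
    {S : {set 'I_n}} {w : Omega} :
  comp_cond E S w -> recursive_value x S (conj_fun E x S w).
Proof.
move=> Sw; rewrite /conj_fun.
case: ifPn => [_ | notT]; first exact: Or32.
case: ifPn => [_ | noF]; first exact: Or31.
apply: Or33; exists (void_set E S w); last by split=> //; exact: void_set_proper.
move: notT; rewrite negb_forall_in => /exists_inP[i iS iT].
move: noF; rewrite negb_exists_in => /forall_inP /(_ i iS) iF.
by apply/set0Pn; exists i; rewrite inE iS in_ce_void iT iF.
Qed.

(** In the third case some conditional event is not false and none is true, so
    that one is void. *)
Lemma disj_fun_recursive {R : realType} {Omega : Type} {n : nat}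
    (E : 'I_n -> condEvent Omega) (y : {set 'I_n} -> R)
    {S : {set 'I_n}} {w : Omega} :
  comp_cond E S w -> recursive_value y S (disj_fun E y S w).
Proof.
move=> Sw; rewrite /disj_fun.
case: ifPn => [_ | noT]; first exact: Or32.
case: ifPn => [_ | notF]; first exact: Or31.
apply: Or33; exists (void_set E S w); last by split=> //; exact: void_set_proper.
move: notF; rewrite negb_forall_in => /exists_inP[i iS iF].
move: noT; rewrite negb_exists_in => /forall_inP /(_ i iS) iT.
by apply/set0Pn; exists i; rewrite inE iS in_ce_void iT iF.
Qed.

Lemma crq_val_in01 {R : realType} {Omega : Type} (X : condRQ R Omega) (mu : R) :
  (forall w, crq_cond X w -> 0 <= crq_fun X w <= 1) -> 0 <= mu <= 1 ->
  forall w, crq_val X mu w \in `[0, 1].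
Proof.
move=> X01 mu01 w; rewrite in_itv /= /crq_val !indicE in_setC.
case: (boolP (w \in crq_cond X)) => [/set_mem Xw | _] /=.
  by rewrite mulr1 mulr0 addr0; exact: X01.
by rewrite mulr1 mulr0 add0r.
Qed.

Theorem theorem9 (R : realType) (Omega : Type) (n : nat) (n_gt0 : (0 < n)%N)
    (E : 'I_n -> condEvent Omega) (x y : {set 'I_n} -> R)
    (xy_coherent : coherent_compounds E x y) :
  let Cn := crq_val (conjunction E x (setT_ord_neq0 n_gt0)) (x [set: 'I_n]%SET) in
  let Dn := crq_val (disjunction E y (setT_ord_neq0 n_gt0)) (y [set: 'I_n]%SET) in
  (forall w : Omega, Cn w \in `[0, 1]) /\ (forall w : Omega, Dn w \in `[0, 1]).
Proof.
have [_ coh] := xy_coherent.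
have x01 : forall S : {set 'I_n}, S != finset.set0 -> 0 <= x S <= 1.
  apply: prevision_between01 => S S0.
  have [w1 [w2 [/= K1 K2 bds]]] :=
    coherent_between (inl (exist _ S S0 : neset n)) coh.
  exists (conj_fun E x S w1), (conj_fun E x S w2).
  by split=> //; exact: conj_fun_recursive.
have y01 : forall S : {set 'I_n}, S != finset.set0 -> 0 <= y S <= 1.
  apply: prevision_between01 => S S0.
  have [w1 [w2 [/= K1 K2 bds]]] :=
    coherent_between (inr (exist _ S S0 : neset n)) coh.
  exists (disj_fun E y S w1), (disj_fun E y S w2).
  by split=> //; exact: disj_fun_recursive.
have T0 := setT_ord_neq0 n_gt0.
split; apply: crq_val_in01; [move=> w /= Kw | exact: x01 |
                             move=> w /= Kw | exact: y01].
- by apply: recursive_value_between01 (conj_fun_recursive E x Kw) => V V0 _;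
     exact: x01.
- by apply: recursive_value_between01 (disj_fun_recursive E y Kw) => V V0 _;
     exact: y01.
Qed.
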